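(* Let $m,n$ be positive integers and let $c,z,u_1,\dots,u_n,v_1,\dots,v_m$ be complex parameters in general position, with $z\ne1$ if $n>m$. (I) For $n\ge m$, $$F_{n,m}^{(z)}(\overline u|\overline v)=\frac{\prod_{i=1}^m\prod_{k=1}^n(v_i-u_k)}{\prod_{1\le i<j\le m}(v_j-v_i)\prod_{1\le i<j\le n}(u_i-u_j)}\det_{1\le i,j\le n}(Y),$$ where $Y$ is the $n\times n$ matrix with $Y_{ij}=\frac{1}{v_i-u_j}-z\frac{1}{v_i-u_j-c}$ for $1\le i\le m$, $1\le j\le n$, and $Y_{ij}=u_j^{n-i}$ for $m+1\le i\le n$, $1\le j\le n$; and $$G_{n,m}^{(z)}(\overline u|\overline v)=(1-z)^{m-n}\frac{\prod_{i=1}^m\prod_{k=1}^n(v_i-u_k)}{\prod_{1\le i<j\le m}(v_j-v_i)\prod_{1\le i<j\le n}(u_i-u_j)}\det_{1\le i,j\le n}(Z),$$ where $Z$ is the $n\times n$ matrix with $Z_{ij}=\frac{1}{v_i-u_j}-z\frac{1}{v_i-u_j-c}$ for $1\le i\le m$, $1\le j\le n$, and $Z_{ij}=u_j^{n-i}-z(u_j+c)^{n-i}$ for $m+1\le i\le n$, $1\le j\le n$. (II) For $n<m$, $$F_{n,m}^{(z)}(\overline u|\overline v)=\frac{\prod_{i=1}^m\prod_{k=1}^n(u_k-v_i)}{\prod_{1\le i<j\le m}(v_i-v_j)\prod_{1\le i<j\le n}(u_j-u_i)}\det_{1\le i,j\le m}(U),$$ where $U$ is the $m\times m$ matrix with $U_{ij}=\frac{1}{u_i-v_j}-z\frac{1}{u_i-v_j+c}$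 for $1\le i\le n$, $1\le j\le m$, and $U_{ij}=v_j^{m-i}-z(v_j-c)^{m-i}$ for $n+1\le i\le m$, $1\le j\le m$; and $$G_{n,m}^{(z)}(\overline u|\overline v)=(1-z)^{m-n}\frac{\prod_{i=1}^m\prod_{k=1}^n(u_k-v_i)}{\prod_{1\le i<j\le m}(v_i-v_j)\prod_{1\le i<j\le n}(u_j-u_i)}\det_{1\le i,j\le m}(V),$$ where $V$ is the $m\times m$ matrix with $V_{ij}=\frac{1}{u_i-v_j}-z\frac{1}{u_i-v_j+c}$ for $1\le i\le n$, $1\le j\le m$, and $V_{ij}=v_j^{m-i}$ for $n+1\le i\le m$, $1\le j\le m$.
   Context: Write $[1,\dots,n]=\{1,\dots,n\}$, $|K|$ for the cardinality of a set $K$, $\overline u=\{u_1,\dots,u_n\}$, $\overline v=\{v_1,\dots,v_m\}$; $j\notin K$ means $j$ lies in the complement of $K$ in the index set over which subsets are taken. The rational source functions are $$F_{n,m}^{(z)}(\overline u|\overline v)=\sum_{K\subset[1,\dots,m]}(-z)^{|K|}\prod_{i\in K,\,j\notin K}\frac{v_i-v_j-c}{v_i-v_j}\prod_{i\in K,\,1\le k\le n}\frac{v_i-u_k}{v_i-u_k-c},$$ $$G_{n,m}^{(z)}(\overline u|\overline v)=(1-z)^{m-n}\sum_{K\subset[1,\dots,n]}(-z)^{|K|}\prod_{i\in K,\,j\notin K}\frac{u_i-u_j+c}{u_i-u_j}\prod_{i\in K,\,1\le k\le m}\frac{u_i-v_k}{u_i-v_k+c}.$$ ''In general position'' means that zeros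 of all factors in denominators are avoided. *)

(* Defs.v *)
From HB Require Import structures.
From mathcomp Require Import all_boot all_order all_algebra.

Set Implicit Arguments.
Unset Strict Implicit.
Unset Printing Implicit Defensive.

Import GRing.Theory.
Local Open Scope ring_scope.

(* Indices are 0-based ordinals, so the exponent n - i of a 1-based row i
   appears as n - i.+1. *)

Section SourceFunctions.
Variables (C : fieldType) (n m : nat) (c z : C).
Variables (u : 'I_n -> C) (v : 'I_m -> C).

Definition sourceF : C :=
  \sum_(K : {set 'I_m})
    (- z) ^+ #|K|
    * (\prod_(i in K) \prod_(j | j \notin K) ((v i - v j - c) / (v i - v j)))
    * (\prod_(i in K) \prod_(k < n) ((v i - u k) / (v i - u k - c))).

(* The exponent m - n is an integer, negative when n > m. *)
Definition sourceG : C :=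
  (1 - z) ^ (m%:Z - n%:Z) *
  \sum_(K : {set 'I_n})
    (- z) ^+ #|K|
    * (\prod_(i in K) \prod_(j | j \notin K) ((u i - u j + c) / (u i - u j)))
    * (\prod_(i in K) \prod_(k < m) ((u i - v k) / (u i - v k + c))).

(* The zeros of every denominator of the source functions and of their
   determinantal expressions are avoided; u i - v k + c is the opposite of
   v k - u i - c. *)
Definition general_position : Prop :=
  [/\ forall i j : 'I_n, i != j -> u i - u j != 0,
      forall i j : 'I_m, i != j -> v i - v j != 0,
      forall (i : 'I_m) (k : 'I_n), v i - u k != 0 &
      forall (i : 'I_m) (k : 'I_n), v i - u k - c != 0].

End SourceFunctions.

(* The N x N matrix whose first p rows (p <= N) are given by top and whose
   remaining rows are given by bot. *)
Definition stacked_mx (C : fieldType) (p N : nat)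
    (top : 'I_p -> 'I_N -> C) (bot : 'I_N -> 'I_N -> C) : 'M[C]_N :=
  \matrix_(i < N, j < N)
    (if insub (i : nat) is Some i' then top i' j else bot i j).

Section Matrices.
Variables (C : fieldType) (n m : nat) (c z : C).
Variables (u : 'I_n -> C) (v : 'I_m -> C).

Definition mxY : 'M[C]_n :=
  stacked_mx (fun (i : 'I_m) j => 1 / (v i - u j) - z * (1 / (v i - u j - c)))
             (fun i j => u j ^+ (n - i.+1)).

Definition mxZ : 'M[C]_n :=
  stacked_mx (fun (i : 'I_m) j => 1 / (v i - u j) - z * (1 / (v i - u j - c)))
             (fun i j => u j ^+ (n - i.+1) - z * (u j + c) ^+ (n - i.+1)).

Definition mxU : 'M[C]_m :=
  stacked_mx (fun (i : 'I_n) j => 1 / (u i - v j) - z * (1 / (u i - v j + c)))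
             (fun i j => v j ^+ (m - i.+1) - z * (v j - c) ^+ (m - i.+1)).

Definition mxV : 'M[C]_m :=
  stacked_mx (fun (i : 'I_n) j => 1 / (u i - v j) - z * (1 / (u i - v j + c)))
             (fun i j => v j ^+ (m - i.+1)).

End Matrices.

(* Main.v *)
Require Import Defs.
From HB Require Import structures.
From mathcomp Require Import all_boot all_order all_algebra.
From mathcomp Require Import perm ring.
From mathcomp Require Import reals complex.

Set Implicit Arguments.
Unset Strict Implicit.
Unset Printing Implicit Defensive.

(** Both subset sums are multilinear expansions of the determinants, summand
    by summand.

    For n >= m, the i-th of the m fractional rows of Y is
    1/(v_i - u_j) - z/((v_i - c) - u_j): the row with pole v_i minus z times
    the row with pole v_i - c.  Multilinearity in these rows
    ([det_expand_top_rows]) writes det Y as the sum over the subsets K of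
    [1,...,m] of (-z)^|K| times a Cauchy-Vandermonde determinant whose poles
    are v_i - c for i in K and v_i otherwise.  In the same way the j-th column
    of Z is f(u_j) - z f(u_j + c) for one and the same vector f of functions,
    so multilinearity in the columns ([det_expand_columns]) writes det Z as a
    sum of Cauchy-Vandermonde determinants with nodes u_j + c for j in K and
    u_j otherwise.

    A Cauchy-Vandermonde determinant is the product of the differences of
    its poles and of its nodes, divided by the product of all pole-node
    differences ([det_cauchy_vandermonde]).  Divided by its unshifted
    version, the product of pole-node differences gives the factors of
    the source function that mix u and v; in the quotient of shifted by
    unshifted differences, two indices on the same side of K cancel, and
    only the pairs (i in K, j not in K) remain ([diffprod_shift_ratio]).

    The case n < m is the case n >= m after exchanging u with v and c with
    -c: this turns F into the sum defining G, U into Z and V into Y. *)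

Import Order.TTheory GRing.Theory Num.Theory.
Local Open Scope ring_scope.

(** * Multilinear expansion of determinants over subsets *)

Section Expansion.
Variable C : comNzRingType.

Lemma prod_sub_expand (I : finType) (z : C) (a b : I -> C) :
  \prod_i (a i - z * b i) =
  \sum_(K : {set I}) (- z) ^+ #|K| * \prod_i (if i \in K then b i else a i).
Proof.
under eq_bigr => i _ do rewrite addrC -mulNr.
rewrite bigA_distr; apply: eq_bigr => K _.
rewrite -prodr_const [in RHS]big_mkcond /= -big_split /=.
by apply: eq_bigr => i _; case: ifP => _; rewrite ?mul1r.
Qed.

(** This splits a product along the two parts of a stacked matrix, whose rows
    are selected by [insub]. *)
Lemma prod_insub (m n : nat) (f : 'I_m -> C) (g : 'I_n -> C) :
  (m <= n)%N ->
  \prod_(i < n) (if insub (i : nat) is Some a then f a else g i) =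
  \prod_(a < m) f a * \prod_(i < n | (m <= i)%N) g i.
Proof.
move=> lemn; rewrite (bigID (fun i : 'I_n => (i < m)%N)) /=; congr (_ * _).
  by rewrite (big_ord_narrow lemn); apply: eq_bigr => a _; rewrite /= valK.
apply: eq_big => [i|i im]; first by rewrite -leqNgt.
by rewrite insubN.
Qed.

Lemma det_expand_columns (n : nat) (z : C) (a b : 'I_n -> 'I_n -> C) :
  \det (\matrix_(i, j) (a i j - z * b i j)) =
  \sum_(K : {set 'I_n}) (- z) ^+ #|K|
    * \det (\matrix_(i, j) (if j \in K then b i j else a i j)).
Proof.
under [RHS]eq_bigr => K _ do rewrite -det_tr mulr_sumr.
rewrite exchange_big -det_tr; apply: eq_bigr => s _ /=.
under eq_bigr => i _ do rewrite !mxE.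
rewrite prod_sub_expand mulr_sumr; apply: eq_bigr => K _.
by rewrite mulrCA; do 2!congr (_ * _); apply: eq_bigr => i _; rewrite !mxE.
Qed.

End Expansion.

Section OverField.
Variable C : fieldType.

(** Only the m rows with a fraction are sums, so in the Leibniz formula only
    those factors get distributed and K ranges over subsets of 'I_m. *)
Lemma det_expand_top_rows (m n : nat) (z : C) (a b : 'I_m -> 'I_n -> C)
    (bot : 'I_n -> 'I_n -> C) : (m <= n)%N ->
  \det (stacked_mx (fun i j => a i j - z * b i j) bot) =
  \sum_(K : {set 'I_m}) (- z) ^+ #|K|
    * \det (stacked_mx (fun i j => if i \in K then b i j else a i j) bot).
Proof.
move=> lemn; under [RHS]eq_bigr => K _ do rewrite mulr_sumr.
have top_bot (top : 'I_m -> 'I_n -> C) (s : {perm 'I_n}) :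
    \prod_i stacked_mx top bot i (s i) =
    \prod_(i < m) top i (s (widen_ord lemn i))
      * \prod_(i < n | (m <= i)%N) bot i (s i).
  rewrite -prod_insub //; apply: eq_bigr => i _; rewrite mxE.
  by case: insubP => // i' _ i'i; congr (top i' (s _)); apply: val_inj.
rewrite exchange_big; apply: eq_bigr => s _ /=.
rewrite top_bot prod_sub_expand mulr_suml mulr_sumr.
by apply: eq_bigr => K _; rewrite top_bot -mulrA mulrCA.
Qed.

(** * The Cauchy-Vandermonde determinant *)

(** Reversing both the rows and the columns is a conjugation by a permutation
    matrix, so no sign appears between decreasing and increasing powers. *)
Lemma det_vandermonde_rev (n : nat) (x : 'I_n -> C) :
  \det (\matrix_(i, j) x j ^+ (n - i.+1)) =
  \prod_(i < n) \prod_(j < n | (i < j)%N) (x i - x j).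
Proof.
pose s : {perm 'I_n} := perm (@rev_ord_inj n).
pose V := Vandermonde n (\row_j x (rev_ord j)).
have -> : \matrix_(i, j) x j ^+ (n - i.+1) = row_perm s (col_perm s V).
  by apply/matrixP => i j; rewrite !mxE !permE rev_ordK.
rewrite row_permE col_permE !det_mulmx !det_perm odd_permV mulrCA -expr2.
rewrite sqrr_sign mulr1 det_Vandermonde.
under eq_bigr => i _ do (under eq_bigr => j _ do rewrite !mxE).
rewrite (reindex_inj rev_ord_inj) /=.
under eq_bigr => i _ do rewrite rev_ordK (reindex_inj rev_ord_inj) /=.
rewrite (exchange_big_dep xpredT) //=; apply: eq_bigr => i _.
apply: eq_big => [j|j _]; last by rewrite rev_ordK.
by rewrite ltn_sub2lE // ltnS.
Qed.

Definition cauchy_vandermonde (m n : nat) (w : 'I_m -> C) (x : 'I_n -> C) :=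
  stacked_mx (fun i j => 1 / (w i - x j)) (fun i j => x j ^+ (n - i.+1)).

Lemma insub_lift0 (m i : nat) :
  insub i.+1 = omap (lift ord0) (insub i : option 'I_m) :> option 'I_m.+1.
Proof.
case: (insubP 'I_m i) => [a _ ai|im] /=; last by rewrite insubN.
by rewrite -ai -lift0 valK.
Qed.

(** Trading the pole w_0 for one more power.  Multiplied by w_0 - x, the
    function 1/(w_0 - x) becomes 1, the function 1/(w_a - x) becomes
    1 + (w_0 - w_a)/(w_a - x), and x^k becomes w_0 x^k - x^(k+1).  All of
    these are combinations of the functions 1/(w_a - x) with a > 0 and of one
    more power of x, so the matrix factors as T times the matrix with one pole
    less.  As rows with poles come first and powers decrease, every row but
    the first of T has its leading term one place to the left of the
    diagonal, while row 0 has its only entry in the last column: expanding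
    along row 0 leaves a triangular minor.  The sign of that expansion cancels
    the signs on the diagonal of the minor. *)
Lemma det_cauchy_vandermonde_step (m N : nat) (w : 'I_m.+1 -> C)
    (x : 'I_N.+1 -> C) : (m <= N)%N -> (forall i j, w i - x j != 0) ->
  \det (cauchy_vandermonde w x) * \prod_j (w ord0 - x j) =
  \prod_(a < m) (w (lift ord0 a) - w ord0)
  * \det (cauchy_vandermonde (w \o lift ord0) x).
Proof.
move=> lemN wx; set w0 := w ord0; set W' := cauchy_vandermonde (w \o _) x.
(* [t i] is row i + 1 of T: [lift ord_max i] is the column of index i and
   [lift ord0 i] that of index i + 1; the last column is the constant 1. *)
pose t (i : 'I_N) : 'rV[C]_N.+1 :=
  if insub (i : nat) is Some a
  then (w0 - w (lift (ord0 : 'I_m.+1) a)) *: delta_mx 0 (lift ord_max i)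
       + delta_mx 0 ord_max
  else - delta_mx 0 (lift ord_max i) + w0 *: delta_mx 0 (lift ord0 i).
pose T : 'M[C]_N.+1 :=
  \matrix_i (if unlift ord0 i is Some i' then t i' else delta_mx 0 ord_max).
have W'last j : W' ord_max j = 1.
  by rewrite mxE insubN /= ?subnn // -leqNgt.
have W'lift i j : W' (lift ord_max i) j =
    if insub (i : nat) is Some a then 1 / (w (lift (ord0 : 'I_m.+1) a) - x j)
    else x j ^+ (N - i).
  by rewrite mxE lift_max; case: insub => //=; rewrite subSS.
have W'low (i : 'I_N) j : (m <= i)%N ->
    W' (lift ord0 i) j = x j ^+ (N - i.+1).
  by move=> mi; rewrite mxE lift0 insubN ?subSS //= -leqNgt ltnW.
clearbody W'.
have factor : cauchy_vandermonde w x *m diag_mx (\row_j (w0 - x j)) = T *m W'.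
  apply/row_matrixP => i; apply/rowP => j.
  rewrite [row i (T *m _)]row_mul rowK mul_mx_diag 2![LHS]mxE [X in X * _]mxE.
  rewrite [X in _ * X]mxE.
  case: (unliftP ord0 i) => [i'|] ->; last first.
    rewrite -rowE mxE W'last (@insubT _ _ 'I_m.+1 0%N) //=.
    rewrite (_ : Sub _ _ = ord0); last exact: val_inj.
    by rewrite mul1r mulVf // wx.
  rewrite lift0 insub_lift0 /t.
  case: insubP => [a _ ai|]; rewrite mulmxDl -?scalemxAl ?mulNmx -!rowE !mxE /=.
    rewrite W'last W'lift -ai valK.
    by field; rewrite !wx.
  rewrite -leqNgt => mi; rewrite W'low // W'lift insubN -?leqNgt //.
  by rewrite subSS -[(N - i')%N]subnSK // exprS; ring.
have minorE : row' ord0 (col' ord_max T) = \matrix_(i, k)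
    (if insub (i : nat) is Some a
    then (w0 - w (lift (ord0 : 'I_m.+1) a)) * (k == i)%:R
    else - (k == i)%:R + w0 * (k == i.+1 :> nat)%:R).
  apply/matrixP => i k; rewrite !mxE liftK /t.
  case: insubP => [a _ _|_]; rewrite !mxE (inj_eq lift_inj) /=.
    by rewrite [_ == ord_max]eq_sym (negPf (neq_lift _ _)) addr0.
  rewrite -[lift _ k == lift ord0 i]/(lift ord_max k == lift ord0 i :> nat).
  by rewrite lift_max lift0.
have -> : \prod_j (w0 - x j) = \det (diag_mx (\row_j (w0 - x j))).
  by rewrite det_diag; apply: eq_bigr => j _; rewrite mxE.
rewrite -det_mulmx factor det_mulmx; congr (_ * _).
rewrite (expand_det_row _ ord0) (bigD1 ord_max) //= big1 ?addr0; last first.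
  by move=> j nj; rewrite !mxE unlift_none mxE (negPf nj) andbF mul0r.
rewrite !mxE unlift_none mxE !eqxx mul1r /cofactor add0n minorE -det_tr.
rewrite det_trig; last first.
  apply/is_trig_mxP => i j ij; rewrite !mxE.
  case: insub => *; rewrite -val_eqE !ltn_eqF ?oppr0 ?mulr0 ?addr0 //.
  by rewrite ltnS ltnW.
transitivity ((-1) ^+ N * \prod_(i < N) - (if insub (i : nat) is Some a
    then w (lift (ord0 : 'I_m.+1) a) - w0 else 1)).
  congr (_ * _); apply: eq_bigr => i _; rewrite !mxE eqxx ltn_eqF //.
  rewrite mulr0 addr0.
  by case: insub => *; rewrite ?mulr1 ?opprB.
rewrite prodrN card_ord mulrA -expr2 sqrr_sign mul1r.
by rewrite (prod_insub _ (fun=> 1)) // big1_eq mulr1.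
Qed.

(** Induction on the number of poles with the nodes x fixed, down to a
    Vandermonde determinant.  The poles may coincide, which is essential: in
    the expansion of Y a shifted pole v_i - c can be equal to some v_j. *)
Lemma det_cauchy_vandermonde (m n : nat) (w : 'I_m -> C) (x : 'I_n -> C) :
  (m <= n)%N -> (forall i j, w i - x j != 0) ->
  \det (cauchy_vandermonde w x) =
  (\prod_(i < m) \prod_(j < m | (i < j)%N) (w j - w i))
  * (\prod_(i < n) \prod_(j < n | (i < j)%N) (x i - x j))
  / \prod_(i < m) \prod_(k < n) (w i - x k).
Proof.
elim: m w => [|m IHm] w lemn wx.
  rewrite !big_ord0 mul1r divr1 -det_vandermonde_rev; congr (\det _).
  by apply/matrixP => i j; rewrite !mxE insubN.
case: n x IHm lemn wx => // N x IHm lemN wx.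
have w0x : \prod_j (w ord0 - x j) != 0 by apply/prodf_neq0 => j _.
have wx' i j : (w \o lift ord0) i - x j != 0 by apply: wx.
have P0 : \prod_(i < m) \prod_(k < N.+1) (w (lift ord0 i) - x k) != 0.
  by do 2![apply/prodf_neq0 => ? _]; apply: wx.
have diffS : \prod_(i < m.+1) \prod_(j < m.+1 | (i < j)%N) (w j - w i)
    = (\prod_(a < m) (w (lift ord0 a) - w ord0))
      * \prod_(i < m) \prod_(j < m | (i < j)%N)
          (w (lift ord0 j) - w (lift ord0 i)).
  rewrite big_ord_recl; congr (_ * _).
    by rewrite big_mkcond big_ord_recl /= mul1r.
  apply: eq_bigr => i _; rewrite big_mkcond big_ord_recl /= mul1r.
  by rewrite [RHS]big_mkcond.
apply: (mulIf w0x); rewrite det_cauchy_vandermonde_step // IHm 1?ltnW //.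
rewrite diffS [\prod_(i < m.+1) \prod_(k < _) _]big_ord_recl /=.
by field; rewrite w0x P0.
Qed.

(** * Products of differences under a shift of the points in K *)

(** A symmetric weight does not see the order of a pair, so a pair that is
    separated by K can be listed with its element of K first. *)
Lemma prod_pairs_cut (n : nat) (K : {set 'I_n}) (h : 'I_n -> 'I_n -> C) :
  (forall i j, h i j = h j i) ->
  (forall i j, i != j -> (i \in K) = (j \in K) -> h i j = 1) ->
  \prod_(i < n) \prod_(j < n | (i < j)%N) h i j =
  \prod_(i in K) \prod_(j | j \notin K) h i j.
Proof.
move=> hC h1.
pose A (i j : 'I_n) := (i \in K) && (j \notin K).
have -> : \prod_(i < n) \prod_(j < n | (i < j)%N) h i j =
    (\prod_(i < n) \prod_(j < n | (i < j)%N && A i j) h i j)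
    * \prod_(i < n) \prod_(j < n | (i < j)%N && A j i) h i j.
  rewrite -big_split /=; apply: eq_bigr => i _.
  rewrite (bigID (A i)) /=; congr (_ * _).
  rewrite (bigID (A^~ i)) /= [X in _ * X]big1 ?mulr1.
    apply: eq_bigl => j; rewrite /A.
    by do 2!case: (_ \in K); rewrite ?andbF ?andbT.
  move=> j /andP[/andP[ij nA] nA']; apply: h1; first by rewrite neq_ltn ij.
  by move: nA nA'; rewrite /A; do 2!case: (_ \in K).
rewrite [X in _ * X](exchange_big_dep xpredT) //= -big_split /=.
rewrite [RHS]big_mkcond /=; apply: eq_bigr => i _.
case iK: (i \in K); rewrite /A iK /=; last first.
  by rewrite !big_pred0 ?mulr1 // => j; rewrite andbF.
rewrite [RHS](bigID (fun j : 'I_n => (i < j)%N)) /=; congr (_ * _).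
  by apply: eq_bigl => j; rewrite andbC.
apply: eq_big => [j|j _]; last exact: hC.
rewrite andbC; case jK: (j \in K) => //=; rewrite -leqNgt ltn_neqAle.
by case: eqP => //= /val_inj ji; rewrite ji iK in jK.
Qed.

(** Shifting two points by the same d leaves their difference unchanged; only
    the pairs with exactly one point in K change. *)
Lemma diffprod_shift_ratio (n : nat) (K : {set 'I_n}) (d : C) (v : 'I_n -> C) :
  (forall i j, i != j -> v i - v j != 0) ->
  let w i := if i \in K then v i + d else v i in
  (\prod_(i < n) \prod_(j < n | (i < j)%N) (w i - w j))
    / (\prod_(i < n) \prod_(j < n | (i < j)%N) (v i - v j))
  = \prod_(i in K) \prod_(j | j \notin K) ((v i - v j + d) / (v i - v j)).
Proof.
move=> vv w; rewrite -prodf_div; under eq_bigr => i _ do rewrite -prodf_div.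
rewrite (@prod_pairs_cut _ K (fun i j => (w i - w j) / (v i - v j))).
- apply: eq_bigr => i iK; apply: eq_bigr => j jK.
  by rewrite /w iK (negPf jK) addrAC.
- by move=> i j; rewrite -opprB -[v i - _]opprB invrN mulrNN.
- move=> i j /vv vij; rewrite /w => ->; case: ifP => _; last by rewrite divff.
  by rewrite opprD addrACA subrr addr0 divff.
Qed.

(** The quotient is insensitive to the orientation of the differences.  The
    poles and the nodes of a Cauchy-Vandermonde determinant enter with opposite
    orientations, hence the two forms. *)
Lemma diffprod_shift_ratioC (n : nat) (K : {set 'I_n}) (d : C)
    (v : 'I_n -> C) :
  (forall i j, i != j -> v i - v j != 0) ->
  let w i := if i \in K then v i + d else v i in
  (\prod_(i < n) \prod_(j < n | (i < j)%N) (w j - w i))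
    / (\prod_(i < n) \prod_(j < n | (i < j)%N) (v j - v i))
  = \prod_(i in K) \prod_(j | j \notin K) ((v i - v j + d) / (v i - v j)).
Proof.
move=> vv w; rewrite -(diffprod_shift_ratio _ _ vv) -!prodf_div.
apply: eq_bigr => i _; rewrite -!prodf_div; apply: eq_bigr => j _.
by rewrite -opprB -[v j - _]opprB invrN mulrNN.
Qed.

Lemma prod_pairs_neq0 (n : nat) (h : 'I_n -> 'I_n -> C) :
  (forall i j, i != j -> h i j != 0) ->
  \prod_(i < n) \prod_(j < n | (i < j)%N) h i j != 0.
Proof.
move=> h0; apply/prodf_neq0 => i _; apply/prodf_neq0 => j ij.
by apply: h0; rewrite neq_ltn ij.
Qed.

(** * The source functions as determinants for n >= m *)

Lemma sourceF_det (m n : nat) (c z : C) (u : 'I_n -> C) (v : 'I_m -> C) :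
  general_position c u v -> (m <= n)%N ->
  sourceF c z u v =
    (\prod_(i < m) \prod_(k < n) (v i - u k))
    / ((\prod_(i < m) \prod_(j < m | (i < j)%N) (v j - v i))
       * (\prod_(i < n) \prod_(j < n | (i < j)%N) (u i - u j)))
    * \det (mxY c z u v).
Proof.
case=> uu vv vu vuc lemn; rewrite det_expand_top_rows // mulr_sumr.
apply: eq_bigr => K _; pose w i := if i \in K then v i - c else v i.
have wu i k : w i - u k != 0 by rewrite /w; case: ifP; rewrite // addrAC.
rewrite (_ : stacked_mx _ _ = cauchy_vandermonde w u); last first.
  apply/matrixP => i j; rewrite !mxE; case: insub => // i'.
  by rewrite /w; case: ifP; rewrite // addrAC.
rewrite det_cauchy_vandermonde // -(diffprod_shift_ratioC _ _ vv) -/w.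
have -> : \prod_(i in K) \prod_(k < n) ((v i - u k) / (v i - u k - c)) =
    (\prod_(i < m) \prod_(k < n) (v i - u k))
    / \prod_(i < m) \prod_(k < n) (w i - u k).
  rewrite -prodf_div big_mkcond; apply: eq_bigr => i _; rewrite -prodf_div /w.
  case: ifP => iK; first by apply: eq_bigr => k _; rewrite addrAC.
  by rewrite big1 // => k _; rewrite divff.
have Pw0 : \prod_(i < m) \prod_(k < n) (w i - u k) != 0.
  by do 2![apply/prodf_neq0 => ? _].
have Dv : \prod_(i < m) \prod_(j < m | (i < j)%N) (v j - v i) != 0.
  apply: (@prod_pairs_neq0 _ (fun i j => v j - v i)) => i j.
  by rewrite eq_sym => /vv.
have Du := prod_pairs_neq0 uu.
by field; rewrite Pw0 Dv Du.
Qed.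

Lemma sourceG_sum_det (m n : nat) (c z : C) (u : 'I_n -> C) (v : 'I_m -> C) :
  general_position c u v -> (m <= n)%N ->
  \sum_(K : {set 'I_n})
    (- z) ^+ #|K|
    * (\prod_(i in K) \prod_(j | j \notin K) ((u i - u j + c) / (u i - u j)))
    * (\prod_(i in K) \prod_(k < m) ((u i - v k) / (u i - v k + c))) =
  (\prod_(i < m) \prod_(k < n) (v i - u k))
    / ((\prod_(i < m) \prod_(j < m | (i < j)%N) (v j - v i))
       * (\prod_(i < n) \prod_(j < n | (i < j)%N) (u i - u j)))
    * \det (mxZ c z u v).
Proof.
case=> uu vv vu vuc lemn.
pose x (K : {set 'I_n}) i := if i \in K then u i + c else u i.
have -> : mxZ c z u v = \matrix_(i, j)
    (cauchy_vandermonde v u i j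
     - z * cauchy_vandermonde v (fun k => u k + c) i j).
  apply/matrixP => i j; rewrite !mxE; case: insub => // i'.
  by rewrite opprD addrA.
rewrite det_expand_columns mulr_sumr; apply: eq_bigr => K _.
have vx i k : v i - x K k != 0.
  by rewrite /x; case: ifP; rewrite // opprD addrA.
rewrite [\matrix_(i, j) _](_ : _ = cauchy_vandermonde v (x K)); last first.
  apply/matrixP => i j; rewrite !mxE /x.
  by case: insub => [i'|]; case: ifP.
rewrite det_cauchy_vandermonde // -(diffprod_shift_ratio _ _ uu) -/(x K).
have -> : \prod_(i in K) \prod_(k < m) ((u i - v k) / (u i - v k + c)) =
    (\prod_(i < m) \prod_(k < n) (v i - u k))
    / \prod_(i < m) \prod_(k < n) (v i - x K k).
  rewrite [\prod_(i < m) \prod_(k < n) (v i - u k)]exchange_big.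
  rewrite [\prod_(i < m) \prod_(k < n) (v i - x K k)]exchange_big.
  rewrite -prodf_div big_mkcond /=.
  apply: eq_bigr => i _; rewrite -prodf_div /x; case: ifP => iK.
    apply: eq_bigr => k _.
    by rewrite -mulrNN -invrN opprB [in RHS]opprD addrA [- (_ + c)]opprD opprB.
  by rewrite big1 // => k _; rewrite divff.
have Px0 : \prod_(i < m) \prod_(k < n) (v i - x K k) != 0.
  by do 2![apply/prodf_neq0 => ? _].
have Dv : \prod_(i < m) \prod_(j < m | (i < j)%N) (v j - v i) != 0.
  apply: (@prod_pairs_neq0 _ (fun i j => v j - v i)) => i j.
  by rewrite eq_sym => /vv.
have Du := prod_pairs_neq0 uu.
by field; rewrite Px0 Dv Du.
Qed.

End OverField.

Theorem proposition4p3 (R : realType) (m n : nat) (hm : (0 < m)%N)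
    (hn : (0 < n)%N) (c z : R[i]) (u : 'I_n -> R[i]) (v : 'I_m -> R[i])
    (hgen : general_position c u v) (hz : (m < n)%N -> z != 1) :
  ((m <= n)%N ->
     sourceF c z u v =
       (\prod_(i < m) \prod_(k < n) (v i - u k))
       / ((\prod_(i < m) \prod_(j < m | (i < j)%N) (v j - v i))
          * (\prod_(i < n) \prod_(j < n | (i < j)%N) (u i - u j)))
       * \det (mxY c z u v)
     /\
     sourceG c z u v =
       (1 - z) ^ (m%:Z - n%:Z)
       * ((\prod_(i < m) \prod_(k < n) (v i - u k))
          / ((\prod_(i < m) \prod_(j < m | (i < j)%N) (v j - v i))
             * (\prod_(i < n) \prod_(j < n | (i < j)%N) (u i - u j))))
       * \det (mxZ c z u v))
  /\
  ((n < m)%N ->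
     sourceF c z u v =
       (\prod_(i < m) \prod_(k < n) (u k - v i))
       / ((\prod_(i < m) \prod_(j < m | (i < j)%N) (v i - v j))
          * (\prod_(i < n) \prod_(j < n | (i < j)%N) (u j - u i)))
       * \det (mxU c z u v)
     /\
     sourceG c z u v =
       (1 - z) ^ (m%:Z - n%:Z)
       * ((\prod_(i < m) \prod_(k < n) (u k - v i))
          / ((\prod_(i < m) \prod_(j < m | (i < j)%N) (v i - v j))
             * (\prod_(i < n) \prod_(j < n | (i < j)%N) (u j - u i))))
       * \det (mxV c z u v)).
Proof.
split=> [lemn|ltnm].
  split; first exact: sourceF_det.
  by rewrite /sourceG (sourceG_sum_det z hgen lemn) mulrA.
have hgen' : general_position (- c) v u.
  case: hgen => uu vv vu vuc; split=> // i k; rewrite -oppr_eq0.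
    by rewrite opprB.
  by rewrite opprK opprD opprB.
have UE : mxU c z u v = mxZ (- c) z v u.
  by apply/matrixP => i j; rewrite !mxE; case: insub => // i'; rewrite opprK.
have VE : mxV c z u v = mxY (- c) z v u.
  by apply/matrixP => i j; rewrite !mxE; case: insub => // i'; rewrite opprK.
rewrite UE VE exchange_big [_ * \prod_(i < n) _]mulrC; split.
  exact: sourceG_sum_det hgen' (ltnW ltnm).
rewrite -mulrA -(sourceF_det z hgen' (ltnW ltnm)); congr (_ * _).
apply: eq_bigr => K _; congr (_ * _ * _); apply: eq_bigr => i _.
  by apply: eq_bigr => j _; rewrite opprK.
by apply: eq_bigr => k _; rewrite opprK.
Qed.
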